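(* Let $G$ be a planar log-divergent graph with $h_G,n_G\ge3$. Then $G$ is duality admissible.
   Context: Graphs are finite and may have multiple edges and self-loops. For a graph $G$ let $N_G$ be its number of edges $e_1,\dots,e_{N_G}$, $n_G=|V(G)|-1$, and $h_G=N_G-n_G$. $G$ is log-divergent if $N_G=2h_G$ (equivalently $N_G=2n_G$). Dual graph polynomial: $\varphi_G=\sum_T\prod_{e\in T}\alpha_e\in\mathbb{Z}[\alpha_1,\dots,\alpha_{N_G}]$, summing over spanning trees $T$ of $G$ ($\varphi_G=0$ if $G$ is disconnected). For disjoint $I,J\subset\{1,\dots,N_G\}$ let $\varphi^J_{I}$ be the polynomial in the $N_G-|I|-|J|$ variables $\alpha_k$, $k\notin I\cup J$, obtained from $\varphi_G$ by taking the coefficient of $\prod_{j\in J}\alpha_j$ and setting $\alpha_i=0$ for $i\in I$; i.e. $\varphi^J_I=\sum_{T\supset J,\,T\cap I=\emptyset}\prod_{e\in T\setminus J}\alpha_e$. For $f\in\mathbb{Z}[a_1,\dots,a_M]$ and a prime power $q$, $[f]_q$ is the number of zeros of $f$ (reduced to $\mathbb{F}_q$) in $\mathbb{F}_q^M$. A log-divergent graph $G$ with $h_G,n_G\ge3$ is called duality admissible if for every prime power $q$ one has $[\varphi^J_I]_q\equiv0\bmod q^3$ (zeros counted in $\mathbb{F}_q^{N_G-|I|-|J|}$) for all disjoint $I,J\subset\{1,\dots,N_G\}$ with $|I|<|J|\le n_G$ and $0\le|I|\le n_G-3$. *)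

(* Defs.v *)
(* MathComp; from MathComp-Analysis only the topology, as the notations of
   normedtype clash with those of mpoly. *)
From HB Require Import structures.
From mathcomp Require Import all_boot all_order all_algebra.
From mathcomp Require Import boolp classical_sets reals topology mpoly.

Set Implicit Arguments.
Unset Strict Implicit.
Unset Printing Implicit Defensive.

Import Order.TTheory GRing.Theory Num.Theory.
Import numFieldTopology.Exports.

Local Open Scope ring_scope.

(* The orientation given by [src] and [tgt] is auxiliary: nothing below
   depends on it. Self-loops and parallel edges are allowed. *)
Record multigraph := Multigraph {
  vertex : finType;
  edge : finType;
  src : edge -> vertex;
  tgt : edge -> vertex }.

Section Multigraph.
Variable G : multigraph.
Local Notation V := (vertex G).
Local Notation E := (edge G).

Definition num_edges : nat := #|E|.

Definition graph_rank : nat := #|V|.-1.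

(* An integer, since it is negative when G has fewer than |V| - 1 edges. *)
Definition loop_number : int := num_edges%:Z - graph_rank%:Z.

Definition log_divergent : Prop := num_edges%:Z = 2 * loop_number.

(* A dart is an edge together with a direction of traversal. *)
Definition dart_tail (d : E * bool) : V := if d.2 then tgt d.1 else src d.1.
Definition dart_head (d : E * bool) : V := if d.2 then src d.1 else tgt d.1.

Definition adjacent (T : {set E}) : rel V :=
  fun u v => [exists d : E * bool,
    [&& d.1 \in T, dart_tail d == u & dart_head d == v]].

Definition spanning_connected (T : {set E}) : Prop :=
  forall u v : V, connect (adjacent T) u v.

(* A self-loop is a cycle of length 1, and two parallel edges form a cycle of
   length 2. Distinctness of the edges is not implied by that of the vertices:
   it excludes walking back and forth along a single edge. *)
Definition graph_cycle (c : seq (E * bool)) : bool :=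
  [&& c != [::],
      path.cycle (fun d d' => dart_head d == dart_tail d') c,
      uniq (map fst c) &
      uniq (map dart_tail c)].

Definition acyclic (T : {set E}) : Prop :=
  forall c : seq (E * bool), graph_cycle c -> ~~ all (fun d => d.1 \in T) c.

Definition spanning_tree (T : {set E}) : Prop :=
  spanning_connected T /\ acyclic T.

(* Non-crossing drawing in the plane: [p] places the vertices and [g e]
   parametrizes the edge [e] by [0, 1]; the values of [g e] outside [0, 1] are
   irrelevant. A non-loop is drawn as an arc, a self-loop as a simple closed
   curve. *)
Record plane_drawing (R : realType) (p : V -> R * R) (g : E -> R -> R * R) :
    Prop := PlaneDrawing {
  drawing_vertex_inj : injective p;
  drawing_continuous : forall e, {within `[0, 1], continuous (g e)}%classic;
  drawing_src : forall e, g e 0 = p (src e);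
  drawing_tgt : forall e, g e 1 = p (tgt e);
  drawing_avoids_vertices :
    forall e v t, 0 < t < 1 -> g e t <> p v;
  drawing_edges_inj :
    forall e f s t, 0 < s < 1 -> 0 < t < 1 -> g e s = g f t -> e = f /\ s = t }.

Definition planar (R : realType) : Prop :=
  exists (p : V -> R * R) (g : E -> R -> R * R), plane_drawing p g.

End Multigraph.

Section DualPolynomial.

(* phi^J_I as a polynomial in the variables alpha_e, e \notin I :|: J, where
   ['X_k] stands for the variable of the k-th edge outside I :|: J. For
   J \subset T and T disjoint from I, the edges of T outside I :|: J are those
   of T :\: J. The dual graph polynomial itself is the case I = J = set0. *)
Definition dual_poly (G : multigraph) (I J : {set edge G}) :
    {mpoly int[#|~: (I :|: J)|]} :=
  \sum_(T : {set edge G} |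
          [&& `[< spanning_tree T >], J \subset T & [disjoint T & I]])
    \prod_(k < #|~: (I :|: J)| | enum_val k \in T) 'X_k.

Definition num_zeros (F : finFieldType) (M : nat) (f : {mpoly int[M]}) : nat :=
  #|[set x : {ffun 'I_M -> F} | (map_mpoly (intr : int -> F) f).@[x] == 0]|.

End DualPolynomial.

Definition duality_admissible (G : multigraph) : Prop :=
  [/\ log_divergent G, 3 <= loop_number G, (3 <= graph_rank G)%N &
   forall (F : finFieldType) (I J : {set edge G}),
     [disjoint I & J] ->
     (#|I| < #|J|)%N -> (#|J| <= graph_rank G)%N ->
     (#|I| <= graph_rank G - 3)%N ->
     (#|F| ^ 3 %| num_zeros F (dual_poly I J))%N].

(* Main.v *)
(* Contracting J and deleting I turns the dual polynomial into the determinant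
   of a symmetric k x k matrix A(a) that depends linearly on a in F_q^M, where
   k = n_G - |J| and M = N_G - |I| - |J| (matrix-tree theorem). Then M > 2k and
   M >= k + 3, and this suffices: for every linear family A of symmetric
   matrices with these dimensions the number of a with det A(a) = 0 is divisible
   by q^3.

   To see this let a_c be the number of a for which A(a) has corank c.
   - Counting pairs (a, x) with x A(a) = 0 gives
       sum_c a_c q^c = sum_x q^(M - rank) = 0 mod q^3,
     the rank of a |-> x A(a) being at most k.
   - Counting triples (a, x, y) with x A(a) = y A(a) = 0 gives
       sum_c a_c q^(2c) = 0 mod q^3:
     if x and y are independent, the symmetry relation y A x^T = x A y^T bounds
     the rank of the conditions on a by 2k - 1 <= M - 2, and the pairs
     (x, y + t x) with t in F_q all contribute the same.
   The second congruence yields q^2 | a_0, then the first one q | a_1, and then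
   again the second one q^3 | a_0, while det A(a) = 0 for q^M - a_0 points. *)
From HB Require Import structures.
Require Import Defs.
From mathcomp Require Import all_boot all_order all_algebra all_fingroup.
From mathcomp Require Import mxabelem zify.
From mathcomp Require Import boolp reals mpoly.

Set Implicit Arguments.
Unset Strict Implicit.
Unset Printing Implicit Defensive.

Import GRing.Theory.

Local Open Scope ring_scope.

(** * Counting solutions of linear systems over a finite field *)

Lemma card_mulmx_eq0 (F : finFieldType) (m n : nat) (B : 'M[F]_(m, n)) :
  #|[set a : 'rV[F]_m | a *m B == 0]| = (#|F| ^ (m - \rank B))%N.
Proof.
rewrite -mxrank_ker -card_rowg; apply: eq_card => a.
by rewrite inE mem_rowg sub_kermx.
Qed.

Lemma linear_ker_card (F : finFieldType) (m n : nat)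
    (f : {linear 'rV[F]_m -> 'rV[F]_n}) :
  #|[set a | f a == 0]| = (#|F| ^ (m - \rank (lin1_mx f)))%N.
Proof.
rewrite -card_mulmx_eq0; apply: eq_card => a.
by rewrite !inE mul_rV_lin1.
Qed.

Lemma sum_card_swap (S T : finType) (r : S -> T -> bool) :
  (\sum_(s : S) #|[set t | r s t]| = \sum_(t : T) #|[set s | r s t]|)%N.
Proof.
transitivity (\sum_(s : S) \sum_(t : T) r s t)%N.
  apply: eq_bigr => s _; rewrite -sum1_card big_mkcond /=.
  by apply: eq_bigr => t _; rewrite inE; case: (r s t).
rewrite exchange_big; apply: eq_bigr => t _.
rewrite -sum1_card [RHS]big_mkcond /=.
by apply: eq_bigr => s _; rewrite inE; case: (r s t).
Qed.

(** * Corank counts in a linear family of symmetric matrices *)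

Section SymmetricFamily.
Variables (F : finFieldType) (M k : nat).
Variable A : {linear 'rV[F]_M -> 'M[F]_k}.
Hypothesis A_sym : forall a, (A a)^T = A a.
Hypotheses (M_gt2k : (k.*2 < M)%N) (M_ge_k3 : (k + 3 <= M)%N).

Local Notation q := #|F|.

Definition annihilates (x y : 'rV[F]_k) : {set 'rV[F]_M} :=
  [set a | (x *m A a == 0) && (y *m A a == 0)].

Let act (x : 'rV[F]_k) (a : 'rV[F]_M) : 'rV[F]_k := x *m A a.

Fact act_is_linear x : linear (act x).
Proof. by move=> c a b; rewrite /act linearP mulmxDr -scalemxAr. Qed.
HB.instance Definition _ x :=
  GRing.isLinear.Build F 'rV[F]_M 'rV[F]_k *:%R (act x) (act_is_linear x).

Let act2 (x y : 'rV[F]_k) (a : 'rV[F]_M) : 'rV[F]_(k + k) :=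
  row_mx (x *m A a) (y *m A a).

Fact act2_is_linear x y : linear (act2 x y).
Proof.
move=> c a b; rewrite /act2 linearP !mulmxDr -!scalemxAr.
by rewrite scale_row_mx add_row_mx.
Qed.
HB.instance Definition _ x y :=
  GRing.isLinear.Build F 'rV[F]_M 'rV[F]_(k + k) *:%R (act2 x y)
    (act2_is_linear x y).

Lemma dvdn_card_annihilator (x : 'rV[F]_k) :
  (q ^ 3 %| #|[set a | x *m A a == 0%R]|)%N.
Proof.
rewrite (linear_ker_card (act x)) dvdn_exp2l // leq_subRL.
  by apply: leq_trans M_ge_k3; rewrite leq_add2r rank_leq_col.
exact: rank_leq_row.
Qed.

Lemma dvdn_card_annihilates0 x : (q ^ 3 %| #|annihilates 0%R x|)%N.
Proof.
rewrite (eq_card (B := [set a | x *m A a == 0])) ?dvdn_card_annihilator //.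
by move=> a; rewrite !inE mul0mx eqxx.
Qed.

Lemma annihilatesC x y : annihilates x y = annihilates y x.
Proof. by apply/setP=> a; rewrite !inE andbC. Qed.

(* By symmetry y A x^T = x A y^T, so the 2k linear conditions on [a] given by
   x A = 0 and y A = 0 satisfy a linear relation. *)
Lemma dvdn_card_annihilates x y : y != 0 -> (q ^ 2 %| #|annihilates x y|)%N.
Proof.
move=> y_neq0; pose z := col_mx y^T (- x^T).
have z_neq0 : z != 0.
  apply: contra_neq y_neq0 => /eqP; rewrite col_mx_eq0 => /andP[/eqP y0 _].
  by rewrite -[y]trmxK y0 trmx0.
have Cz : lin1_mx (act2 x y) *m z = 0.
  apply/row_matrixP=> i; rewrite row_mul row0 rowE mul_rV_lin1.
  rewrite /= /act2 mul_row_col mulmxN; apply/eqP; rewrite subr_eq0; apply/eqP.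
  transitivity ((x *m A (delta_mx 0 i) *m y^T)^T).
    by apply/matrixP=> a b; rewrite [RHS]mxE !ord1.
  by rewrite !trmx_mul trmxK A_sym mulmxA.
(* Since [z] is nonzero, the rank is at most 2k - 1, and M >= 2k + 1 leaves a kernel of dimension at
   least 2. *)
have rk := mulmx0_rank_max Cz.
have rz : (0 < \rank z)%N by rewrite lt0n mxrank_eq0.
rewrite (eq_card (B := [set a | act2 x y a == 0])); last first.
  by move=> a; rewrite !inE row_mx_eq0.
rewrite linear_ker_card dvdn_exp2l //.
by move: rk rz M_gt2k; rewrite -addnn; move: (\rank _) (\rank _); lia.
Qed.

Lemma annihilates_shift x y t : annihilates x (y + t *: x) = annihilates x y.
Proof.
apply/setP=> a; rewrite !inE mulmxDl -scalemxAl.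
by case: eqP => //= ->; rewrite scaler0 addr0.
Qed.

(* The lines y + F x are the fibres of the projection onto y_i = 0, where
   x_i != 0; each of them contributes a factor q. *)
Lemma dvdn_sum_annihilates x :
  (q ^ 3 %| \sum_(y : 'rV[F]_k) #|annihilates x y|)%N.
Proof.
case: (eqVneq x 0) => [->|x_neq0].
  by apply: dvdn_sum => y _; apply: dvdn_card_annihilates0.
have /rV0Pn[i xi] := x_neq0.
pose p (y : 'rV[F]_k) := y - (y 0 i / x 0 i) *: x.
have px_inv y t : p (y + t *: x) = p y.
  rewrite /p !mxE mulrDl mulfK // scalerDl opprD addrACA.
  by rewrite subrr addr0.
rewrite (partition_big p predT) //=; apply: dvdn_sum => z _.
(* The fibre over [z] is empty unless [z] is itself the point of its line with i-th coordinate 0. *)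
have [/eqP pz|pz] := boolP (p z == z); last first.
  rewrite big_pred0 // => y; apply: contraNF pz => /eqP <-.
  by rewrite {1}/p !mxE divfK // subrr mul0r scale0r subr0.
rewrite (reindex_onto (fun t : F => z + t *: x)
           (fun y => y 0 i / x 0 i - z 0 i / x 0 i)) /=; last first.
  move=> y /eqP py; rewrite -{1}py /p scalerBl; rewrite -py /p !mxE.
  by rewrite divfK // subrr mul0r scale0r subr0 subrK.
rewrite (eq_big xpredT (fun=> #|annihilates x z|)) => [||t _]; last 2 first.
- by move=> t; rewrite px_inv pz eqxx !mxE mulrDl mulfK // addrC addKr eqxx.
- by rewrite annihilates_shift.
rewrite big_const iter_addn_0 cardT -cardE mulnC expnS.
(* On the line of multiples of [x] the two conditions reduce to x A(a) = 0, and the count for a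
   single vector applies. *)
have [->|z_neq0] := eqVneq z 0; last by rewrite dvdn_mul // dvdn_card_annihilates.
rewrite annihilatesC dvdn_mul //; apply: dvdn_trans (dvdn_card_annihilates0 x).
by rewrite dvdn_exp2l.
Qed.

Let corank a := (k - \rank (A a))%N.

Let card_ker_pow a : #|[set x : 'rV[F]_k | x *m A a == 0]| = (q ^ corank a)%N.
Proof. exact: card_mulmx_eq0. Qed.

Let dvdn_sum_ker : (q ^ 3 %| \sum_(a : 'rV[F]_M) q ^ corank a)%N.
Proof.
under eq_bigr do rewrite -card_ker_pow.
rewrite sum_card_swap; apply: dvdn_sum => x _; exact: dvdn_card_annihilator.
Qed.

Let dvdn_sum_ker2 : (q ^ 3 %| \sum_(a : 'rV[F]_M) q ^ (corank a).*2)%N.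
Proof.
under eq_bigr => a _.
  rewrite -addnn expnD -!card_ker_pow -cardsX.
  rewrite (eq_card (B := [set xy | (xy.1 *m A a == 0) && (xy.2 *m A a == 0)])).
    over.
  by case=> x y; rewrite !inE.
rewrite sum_card_swap -(pair_bigA _ (fun x y => #|annihilates x y|)) /=.
by apply: dvdn_sum => x _; apply: dvdn_sum_annihilates.
Qed.

Lemma dvdn_card_unit_sym_family :
  (q ^ 3 %| #|[set a : 'rV[F]_M | \det (A a) != 0%R]|)%N.
Proof.
have q_gt0 : (0 < q)%N by apply/card_gt0P; exists 0.
have unitE a : (\det (A a) != 0) = (corank a == 0)%N.
  rewrite -unitfE -unitmxE -row_full_unit /row_full /corank subn_eq0.
  by rewrite eqn_leq rank_leq_row.
pose a0 := #|[set a : 'rV[F]_M | \det (A a) != 0]|.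
pose a1 := #|[set a : 'rV[F]_M | corank a == 1%N]|.
(* The values r = 1 and r = 2 give the counts of vectors and of pairs; [b] collects the coranks >=
   2, from which q^(2r) factors out. *)
have split_pow r : exists b, (\sum_(a : 'rV[F]_M) q ^ (r * corank a) =
    a0 + q ^ r * a1 + q ^ (r * 2) * b)%N.
  exists (\sum_(a : 'rV[F]_M | 1 < corank a) q ^ (r * (corank a - 2)))%N.
  rewrite (bigID (fun a => corank a == 0)%N) /=.
  rewrite (bigID (fun a => corank a == 1)%N (fun a => corank a != 0)%N) /= addnA.
  congr (_ + _ + _)%N.
  - rewrite -[a0]muln1 -sum_nat_const; apply: eq_big => a; first by rewrite inE unitE.
    by move/eqP->; rewrite muln0.
  - rewrite mulnC -sum_nat_const; apply: eq_big => a.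
      by rewrite inE; case: (corank a) => [|[]].
    by case/andP=> _ /eqP->; rewrite muln1.
  - rewrite big_distrr /=; apply: eq_big => a; first by case: (corank a) => [|[]].
    case: (corank a) => [|[|c]] // _.
    by rewrite -expnD -mulnDr; congr (_ ^ (_ * _))%N; lia.
have [b1 S1] := split_pow 1%N; have [b2 S2] := split_pow 2%N.
have d1 : (q ^ 3 %| a0 + q * a1 + q ^ 2 * b1)%N.
  by rewrite -[q in (q * _)%N]expn1 -S1; under eq_bigr do rewrite mul1n.
have d2 : (q ^ 3 %| a0 + q ^ 2 * a1)%N.
  have : (q ^ 3 %| a0 + q ^ 2 * a1 + q ^ 4 * b2)%N.
    by rewrite -S2; under eq_bigr do rewrite mul2n.
  by rewrite dvdn_addl // dvdn_mulr // dvdn_exp2l.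
have q2_a0 : (q ^ 2 %| a0)%N.
  have : (q ^ 2 %| a0 + q ^ 2 * a1)%N by apply: dvdn_trans d2; rewrite dvdn_exp2l.
  by rewrite dvdn_addl // dvdn_mulr.
have q_a1 : (q %| a1)%N.
  have : (q ^ 2 %| a0 + q * a1 + q ^ 2 * b1)%N.
    by apply: dvdn_trans d1; rewrite dvdn_exp2l.
  rewrite dvdn_addl; last exact: dvdn_mulr.
  by rewrite dvdn_addr // expnS expn1 dvdn_pmul2l.
by move: d2; rewrite dvdn_addl // expnSr dvdn_mul.
Qed.

End SymmetricFamily.

(** Complement of the previous count: there are q^M points in all, and M >= 3. *)
Lemma dvdn_card_singular_sym_family (F : finFieldType) (M k : nat)
    (A : {linear 'rV[F]_M -> 'M[F]_k}) :
    (forall a, (A a)^T = A a) -> (k.*2 < M)%N -> (k + 3 <= M)%N ->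
  (#|F| ^ 3 %| #|[set a : 'rV[F]_M | \det (A a) == 0%R]|)%N.
Proof.
move=> A_sym M_gt2k M_ge_k3.
set S := [set a | _ == 0].
have card_S : (#|S| + #|~: S| = #|F| ^ M)%N by rewrite cardsC card_mx mul1n.
rewrite -(@dvdn_addl #|~: S|) ?card_S ?dvdn_exp2l ?(leq_trans _ M_ge_k3)
  ?leq_addl //.
have -> : ~: S = [set a | \det (A a) != 0] by apply/setP=> a; rewrite !inE.
exact: dvdn_card_unit_sym_family.
Qed.

(** * The Cauchy-Binet formula *)

(** Leibniz formula with the product of row sums multiplied out: [h] picks the summation index in
    each row. Non-injective [h] may stay, their minors being 0. *)
Lemma det_mulmx_rowsub (R : comNzRingType) (k M : nat)
    (A : 'M[R]_(k, M)) (B : 'M[R]_(M, k)) :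
  \det (A *m B) =
    \sum_(h : {ffun 'I_k -> 'I_M}) (\prod_i A i (h i)) * \det (rowsub h B).
Proof.
under [RHS]eq_bigr do rewrite big_distrr /=.
rewrite exchange_big /=; apply: eq_bigr => s _.
under eq_bigr do rewrite mxE.
rewrite bigA_distr_bigA big_distrr; apply: eq_bigr => h _ /=.
rewrite big_split /= mulrCA; congr (_ * (_ * _)).
by apply: eq_bigr => i _; rewrite mxE.
Qed.

Lemma imset_ord_ex (M k : nat) (S : {set 'I_M}) : #|S| = k ->
  exists2 h : 'I_k -> 'I_M, injective h & [set h i | i : 'I_k] = S.
Proof.
move=> Sk; exists (fun i => enum_val (cast_ord (esym Sk) i)).
  by move=> i j /enum_val_inj/cast_ord_inj.
apply/setP=> a; apply/imsetP/idP => [[i _ ->]|aS]; first exact: enum_valP.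
by exists (cast_ord Sk (enum_rank_in aS a)); rewrite // cast_ordK enum_rankK_in.
Qed.

(* Cauchy-Binet for a Gram matrix; [d S] is the squared maximal minor on the
   rows of S, given through any enumeration of S. *)
Lemma det_weighted_gram (R : comNzRingType) (M k : nat) (W : 'M[R]_(M, k))
    (x : 'rV[R]_M) (d : {set 'I_M} -> R) :
    (forall h : 'I_k -> 'I_M, injective h ->
       (\det (rowsub h W)) ^+ 2 = d [set h i | i : 'I_k]) ->
  \det (W^T *m diag_mx x *m W) =
    \sum_(S : {set 'I_M} | #|S| == k) d S * \prod_(i in S) x 0 i.
Proof.
move=> minorE; rewrite det_mulmx_rowsub.
rewrite (bigID (fun h : {ffun _} => injectiveb h)) /= addrC big1 ?add0r; last first.
  move=> h /injectivePn[i1 [i2 i12 h12]].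
  by rewrite (determinant_alternate i12) ?mulr0 // => j; rewrite !mxE h12.
rewrite (partition_big (fun h : {ffun 'I_k -> 'I_M} => [set h i | i : 'I_k])
           (fun S => #|S| == k)) /=; last first.
  by move=> h /injectiveP hI; rewrite card_imset // card_ord.
apply: eq_bigr => S /eqP Sk; have [h0 h0I h0S] := imset_ord_ex Sk.
rewrite -h0S -minorE // expr2 -mulrA -{1}det_tr.
(* One of the two equal minors is kept as [D0], the other is expanded over permutations s, to be
   matched with the maps h = h0 o s on the left. *)
move D0E: (\det (rowsub h0 W)) => D0.
rewrite [X in X * _]/determinant big_distrl /=.
have h0_im (h : {ffun 'I_k -> 'I_M}) i :
    [set h i | i : 'I_k] = [set h0 i | i : 'I_k] -> exists j, h i == h0 j.
  move=> hE; have : h i \in [set h0 i | i : 'I_k] by rewrite -hE imset_f.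
  by case/imsetP=> j _ ->; exists j.
(* [inv h] is the s with h = h0 o s. For injective [h] with the same image as [h0] the defaults [i]
   and [1] never occur. *)
pose inv (h : {ffun 'I_k -> 'I_M}) : 'S_k :=
  insubd (1%g : 'S_k) [ffun i => odflt i [pick j | h i == h0 j]].
rewrite (reindex_onto (fun s : 'S_k => [ffun i => h0 (s i)]) inv) /=; last first.
  move=> h /andP[/injectiveP hI /eqP hE]; apply/ffunP=> i.
  have pickK j : h0 (odflt j [pick l | h j == h0 l]) = h j.
    case: pickP => [l /eqP -> //|no]; have [l hl] := h0_im h j hE.
    by rewrite no in hl.
  rewrite ffunE /inv -pvalE insubdK ?ffunE //.
  apply/injectiveP=> a b; rewrite !ffunE => /(congr1 h0).
  by rewrite !pickK => /hI.
have comp_inj (s : 'S_k) : injective (fun i => h0 (s i)) by move=> a b /h0I/perm_inj.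
apply: eq_big => s.
  have -> : injectiveb [ffun i => h0 (s i)].
    by apply/injectiveP=> a b; rewrite !ffunE; apply: comp_inj.
  have -> : [set [ffun i => h0 (s i)] i | i : 'I_k] = [set h0 i | i : 'I_k].
    apply/setP=> a; apply/imsetP/imsetP => -[i _ ->]; last first.
      by exists ((s^-1)%g i); rewrite ?ffunE ?permKV.
    by exists (s i); rewrite ?ffunE.
  have pickK j : odflt j [pick l | [ffun i => h0 (s i)] j == h0 l] = s j.
    by case: pickP => [l|/(_ (s j))]; rewrite ffunE ?eqxx // => /eqP/h0I.
  rewrite eqxx /=; apply/eqP/permP => i; rewrite /inv -pvalE insubdK.
    by rewrite ffunE pickK.
  by apply/injectiveP=> a b; rewrite ffunE [RHS]ffunE !pickK => /perm_inj.
move=> _.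
have -> : rowsub [ffun i => h0 (s i)] W = row_perm s (rowsub h0 W).
  by apply/matrixP=> i j; rewrite !mxE ffunE.
rewrite (row_permE s (rowsub h0 W)) det_mulmx det_perm D0E.
have -> : \prod_(i in [set h0 i | i : 'I_k]) x 0 i = \prod_i x 0 (h0 (s i)).
  rewrite big_imset /=; last by move=> a b _ _; apply: h0I.
  by rewrite (reindex_perm s).
rewrite [X in _ = (_ * X) * _](_ : _ = \prod_i W (h0 (s i)) i); last first.
  by apply: eq_bigr => i _; rewrite !mxE.
rewrite [X in X * _ = _](_ : _ =
  (\prod_i W (h0 (s i)) i) * \prod_i x 0 (h0 (s i))); last first.
  by rewrite -big_split /=; apply: eq_bigr => i _; rewrite ffunE mul_mx_diag !mxE.
move: (\prod_i W _ _) (\prod_i x _ _) => w y.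
by rewrite mulrACA [w * _]mulrC [y * _]mulrC.
Qed.

Lemma card_None_Some (X : finType) (S : {set X}) :
  #|None |: [set Some e | e in S]| = #|S|.+1.
Proof.
rewrite cardsU1 card_imset; last exact: Some_inj.
by case: imsetP => // -[].
Qed.

Lemma int_unit_sqr (a b : int) : a * b = 1 -> b ^+ 2 = 1.
Proof.
move/(congr1 absz)/eqP; rewrite abszM muln_eq1 => /andP[_ /eqP b1].
by have [->|->] : b = 1 \/ b = -1 by lia.
Qed.

Lemma det_eq0_mulmxr (R : idomainType) (n : nat) (A : 'M[R]_n) (x : 'cV[R]_n) :
  x != 0 -> A *m x = 0 -> \det A = 0.
Proof.
move=> x_neq0 Ax; have: \det A *: x == 0.
  by rewrite -mul_scalar_mx -mul_adj_mx -mulmxA Ax mulmx0.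
by rewrite scalemx_eq0 (negPf x_neq0) orbF => /eqP.
Qed.

Lemma det_eq0_mulmxl (R : idomainType) (n : nat) (A : 'M[R]_n) (y : 'rV[R]_n) :
  y != 0 -> y *m A = 0 -> \det A = 0.
Proof.
move=> y_neq0 yA; rewrite -det_tr; apply: (@det_eq0_mulmxr _ _ _ y^T).
  by rewrite trmx_eq0.
by rewrite -trmx_mul yA trmx0.
Qed.

(** The heads are the tails rotated by one place; this makes the signed edge vectors of a cycle sum
    to 0. *)
Lemma head_tail_cycle (T : eqType) (U : eqType) (h t : T -> U) (c : seq T) :
  path.cycle (fun a b => h a == t b) c -> perm_eq (map h c) (map t c).
Proof.
case: c => //= a c.
have gen b : path (fun a b => h a == t b) b (rcons c a) ->
    h b :: map h c = rcons (map t c) (t a).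
  elim: c b => [|d c IHc] b /=; first by rewrite andbT => /eqP->.
  by case/andP=> /eqP-> /IHc ->.
by move=> /gen ->; rewrite perm_rcons.
Qed.

(** * Walks and cycles in a multigraph *)

Section Walks.
Variable G : multigraph.
Local Notation V := (vertex G).
Local Notation E := (edge G).
Implicit Types (T : {set E}) (d : E * bool).

Lemma adjacent_sym T : ssrbool.symmetric (adjacent T).
Proof.
suff imp u v : adjacent T u v -> adjacent T v u.
  by move=> u v; apply/idP/idP; apply: imp.
case/existsP=> -[e b] /and3P[eT /eqP <- /eqP <-]; apply/existsP.
by exists (e, ~~ b); rewrite eT; case: b eT; rewrite !eqxx.
Qed.

Lemma adjacent_src_tgt T e : e \in T -> adjacent T (src e) (tgt e).
Proof. by move=> eT; apply/existsP; exists (e, false); rewrite eT !eqxx. Qed.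

(** A later dart on the first edge would bring the walk back to [x]; so in an open walk distinct
    vertices force distinct edges. *)
Lemma dart_walk T (x : V) (p : seq V) :
    path (adjacent T) x p -> uniq (x :: p) ->
  exists c : seq (E * bool),
    [/\ all (fun d => d.1 \in T) c, map (@dart_tail G) c = belast x p,
        map (@dart_head G) c = p & uniq (map fst c)].
Proof.
elim: p x => [|y p IHp] x /=; first by move=> _ _; exists [::].
case/andP=> /existsP[d /and3P[dT /eqP tx /eqP hy]] walk_p /andP[x_notin uniq_p].
have [c [cT tc hc uc]] := IHp y walk_p uniq_p.
exists (d :: c); split; rewrite /= ?dT ?cT ?tx ?tc ?hy ?hc //= uc andbT.
apply: contra x_notin => /mapP[d' d'c dd'].
have td' : dart_tail d' \in y :: p.
  by rewrite mem_belast // -tc map_f.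
have hd' : dart_head d' \in y :: p by rewrite inE -hc map_f // orbT.
move: tx td' hd'; rewrite /dart_tail /dart_head dd'.
by case: (d.2) (d'.2) => -[] <-.
Qed.

(** An edge of [T] missing from [T'] would form a cycle with a simple path in [T'] between its
    ends. *)
Lemma acyclic_connected_sub T T' :
  acyclic T -> T' \subset T -> spanning_connected T' -> T' = T.
Proof.
move=> acT sT'T connT'; apply/eqP; rewrite eqEsubset sT'T /=.
apply/subsetP=> e eT; apply: contraT => eT'.
have /connectP[p0 walk0 last0] := connT' (tgt e) (src e).
case/shortenP: walk0 last0 => p walk uniq_p _ last_p.
have [c [cT' tc hc uc]] := dart_walk walk uniq_p.
have cT : all (fun d => d.1 \in T) c.
  by apply: sub_all cT' => d; apply: (subsetP sT'T).
suff cyc : graph_cycle ((e, false) :: c) by have := acT _ cyc; rewrite /= eT cT.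
rewrite /graph_cycle /= uc /= andbT.
have e_notin : e \notin map fst c.
  by apply: contra eT' => /mapP[d dc ->]; apply: (allP cT').
rewrite e_notin tc /dart_tail /= last_p -rcons_uniq -lastI uniq_p andbT.
(* The chain condition on darts says that the list of heads is the list of tails shifted by one. *)
have gen x :
    path (fun d d' => dart_head d == dart_tail d') x (rcons c (e, false)) =
    (dart_head x :: map (@dart_head G) c ==
       rcons (map (@dart_tail G) c) (src e)).
  elim: (c) x => [|d c' IHc] x /=; first by rewrite !eqseq_cons.
  by rewrite IHc eqseq_cons.
by rewrite gen hc tc /dart_head /= last_p -lastI.
Qed.

End Walks.

(** * Incidence matrices and spanning trees *)

Section Incidence.
Variables (G : multigraph) (root : vertex G).
Local Notation V := (vertex G).
Local Notation E := (edge G).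
Variables (p : nat) (r : V -> 'I_p) (s : 'I_p -> V).
Hypotheses (rK : cancel r s) (sK : cancel s r).
Implicit Types (T : {set E}) (d : E * bool).

(* Besides the edges there is a row [None], the unit vector of the root: with
   it, spanning trees correspond to bases of the whole space. *)
Definition incidence (R : nzRingType) (o : option E) : 'rV[R]_p :=
  if o is Some e then delta_mx 0 (r (tgt e)) - delta_mx 0 (r (src e))
  else delta_mx 0 (r root).

Definition incmx (R : nzRingType) m (f : 'I_m -> option E) : 'M[R]_(m, p) :=
  \matrix_(i < m) incidence R (f i).

Lemma map_incmx (R S : nzRingType) (g : {rmorphism R -> S}) m
    (f : 'I_m -> option E) :
  map_mx g (incmx R f) = incmx S f.
Proof.
apply/matrixP=> i j; rewrite !mxE; case: (f i) => [e|]; rewrite !mxE.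
  by rewrite rmorphB !rmorph_nat.
by rewrite rmorph_nat.
Qed.

Lemma incidence_dart (R : nzRingType) d :
  (-1) ^+ d.2 *: incidence R (Some d.1) =
    delta_mx 0 (r (dart_head d)) - delta_mx 0 (r (dart_tail d)).
Proof.
case: d => e [] /=; rewrite /dart_head /dart_tail /=; last by rewrite scale1r.
by rewrite scaleN1r opprB.
Qed.

(** Adding to the root vector the signed edge vectors along a walk from the root to [v]
    telescopes. *)
Lemma incmx_span (R : nzRingType) m (f : 'I_m -> option E) T :
    spanning_connected T -> (exists i, f i = None) ->
    (forall e, e \in T -> exists i, f i = Some e) ->
  forall v, exists c : 'rV[R]_m, c *m incmx R f = delta_mx 0 (r v).
Proof.
move=> connT [i0 fi0] fT v.
have /connectP[w walk ->] := connT root v.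
have : exists c : 'rV[R]_m, c *m incmx R f = delta_mx 0 (r root).
  by exists (delta_mx 0 i0); rewrite -rowE rowK fi0.
elim: w (root) walk => [|b w IHw] a //= /andP[/existsP[d]].
case/and3P=> dT /eqP ta /eqP hb walk [c ca]; apply: IHw walk _.
have [i fi] := fT _ dT; exists (c + (-1) ^+ d.2 *: delta_mx 0 i).
rewrite mulmxDl ca -scalemxAl -rowE rowK fi incidence_dart ta hb.
by rewrite addrC subrK.
Qed.

(** The rows span all unit vectors with integer coefficients, so the matrix has an integer
    inverse. *)
Lemma incmx_sqr_det1 (f : 'I_p -> option E) T :
    spanning_connected T -> (exists i, f i = None) ->
    (forall e, e \in T -> exists i, f i = Some e) ->
  (\det (incmx int f)) ^+ 2 = 1.
Proof.
move=> connT fNone fT.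
have /fin_all_exists[c cE] := incmx_span int connT fNone fT.
have : (\matrix_(i < p) c (s i)) *m incmx int f = 1%:M.
  apply/row_matrixP=> i; rewrite row_mul rowK cE sK.
  by rewrite row1.
move/(congr1 (@determinant _ _)); rewrite det_mulmx det1 => dd.
exact: int_unit_sqr dd.
Qed.

(** Otherwise the indicator vector of the vertices unreachable from the root is a nonzero kernel
    vector. *)
Lemma incmx_det_connected (R : idomainType) (f : 'I_p -> option E) :
  \det (incmx R f) != 0 -> spanning_connected [set e | Some e \in codom f].
Proof.
move=> det_neq0; set T := [set e | _].
have csym : connect_sym (adjacent T).
  exact/sym_connect_sym/adjacent_sym.
suff conn_root w : connect (adjacent T) root w.
  by move=> u v; apply: connect_trans (conn_root v); rewrite csym.
apply: contraNT det_neq0 => not_conn.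
pose x : 'cV[R]_p := \col_i (~~ connect (adjacent T) root (s i))%:R.
apply/eqP/(@det_eq0_mulmxr _ _ _ x).
  apply/cV0Pn; exists (r w); rewrite mxE rK not_conn; exact: oner_neq0.
apply/row_matrixP=> i; rewrite row_mul rowK row0.
case fi: (f i) => [e|] /=; last first.
  by rewrite -rowE; apply/rowP=> j; rewrite !mxE rK connect0.
have eT : e \in T by rewrite inE -fi codom_f.
rewrite mulmxBl -!rowE; apply/rowP=> j; rewrite !mxE !rK.
by rewrite (same_connect_r csym (connect1 (adjacent_src_tgt eT))) subrr.
Qed.

(** The entries of an edge row sum to 0, so with edge rows only the all-ones vector lies in the
    kernel. *)
Lemma incmx_det_None (R : idomainType) (f : 'I_p -> option E) :
  \det (incmx R f) != 0 -> None \in codom f.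
Proof.
apply: contraNT => notNone; apply/eqP/(@det_eq0_mulmxr _ _ _ (const_mx 1)).
  by apply/cV0Pn; exists (r root); rewrite mxE oner_neq0.
apply/row_matrixP=> i; rewrite row_mul rowK row0.
case fi: (f i) => [e|] /=; last by case/negP: notNone; rewrite -fi codom_f.
by rewrite mulmxBl -!rowE; apply/rowP=> j; rewrite !mxE subrr.
Qed.

(** The rows of a cycle, signed by direction of traversal, sum to 0. The edges of a cycle being
    distinct, the coefficients of this relation are signs and cannot cancel. *)
Lemma incmx_det_acyclic (R : idomainType) (f : 'I_p -> option E) T :
    injective f -> (forall e, e \in T -> exists i, f i = Some e) ->
  \det (incmx R f) != 0 -> acyclic T.
Proof.
move=> f_inj fT det_neq0 c /and4P[c_neq0 cyc uniq_e _].
apply: contra det_neq0 => /allP cT.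
pose y : 'rV[R]_p := \sum_(d <- c) (-1) ^+ d.2 *: \row_i (f i == Some d.1)%:R.
apply/eqP/(@det_eq0_mulmxl _ _ _ y).
  case: c c_neq0 {cyc} uniq_e cT @y => // d c _ /= /andP[d_notin _] cT.
  have [i fi] := fT _ (cT d (mem_head _ _)).
  apply/rV0Pn; exists i; rewrite big_cons mxE summxE big1_seq => [|d' /= d'c].
    by rewrite addr0 !mxE fi eqxx mulr1 signr_eq0.
  rewrite !mxE fi; case: eqP => [[dd']|]; last by rewrite mulr0.
  by rewrite dd' map_f in d_notin.
rewrite mulmx_suml.
transitivity (\sum_(d <- c) (delta_mx 0 (r (dart_head d)) -
                             delta_mx 0 (r (dart_tail d))) : 'rV[R]_p).
  apply: eq_big_seq => d dc; have [i fi] := fT _ (cT d dc).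
  rewrite -incidence_dart -fi -scalemxAl; congr (_ *: _).
  rewrite -(rowK (fun i => incidence R (f i))) rowE; congr (_ *m _).
  by apply/rowP=> j; rewrite !mxE (inj_eq f_inj) eqxx.
pose delta v : 'rV[R]_p := delta_mx 0 (r v).
rewrite sumrB -(big_map (@dart_head G) xpredT delta).
by rewrite (perm_big _ (head_tail_cycle cyc)) big_map subrr.
Qed.

(** Choose p independent rows among the root and the edges of [T]. The chosen edges already connect
    all vertices, so by acyclicity they are all of [T]. *)
Lemma spanning_tree_card T : spanning_tree T -> #|T|.+1 = p.
Proof.
move=> [connT acT]; pose S := None |: [set Some e | e in T].
have inS o : o \in S -> exists i : 'I_#|S|, enum_val i = o.
  by move=> oS; exists (enum_rank_in oS o); rewrite enum_rankK_in.
have full : row_full (incmx rat (@enum_val _ (mem S))).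
  apply/row_fullP; have /fin_all_exists[c cE] := @incmx_span rat _
    (@enum_val _ (mem S)) T connT (inS None (setU11 _ _))
    (fun e eT => inS _ (setU1r _ (imset_f _ eT))).
  exists (\matrix_(i < p) c (s i)); apply/row_matrixP=> i.
  by rewrite row_mul rowK cE sK row1.
pose f (i : 'I_p) := enum_val (fullrankfun full i).
have f_inj : injective f by move=> i j /enum_val_inj/fullrankfun_inj.
have det_f : \det (incmx rat f) != 0.
  have := fullrowsub_unit full; rewrite unitmxE unitfE.
  by congr (\det _ != 0); apply/matrixP=> i j; rewrite !mxE.
have fS i : f i \in S by apply: enum_valP.
have conn := incmx_det_connected det_f.
have TE : [set e | Some e \in codom f] = T.
  apply: acyclic_connected_sub acT _ conn; apply/subsetP=> e.
  rewrite inE => /codomP[i fi]; have := fS i; rewrite -fi !inE /=.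
  by case/imsetP=> e' e'T [->].
have codomE : codom f =i S.
  move=> o; apply/idP/idP=> [/codomP[i ->] //|]; rewrite !inE.
  case/predU1P=> [->|/imsetP[e eT ->]]; first exact: incmx_det_None det_f.
  by move: eT; rewrite -TE inE.
rewrite -[RHS]card_ord -(card_codom f_inj) (eq_card codomE).
by rewrite card_None_Some.
Qed.

(** Unimodularity behind the matrix-tree theorem; squaring removes the sign, which depends on the
    order of the rows and the orientation. *)
Lemma incmx_sqr_det (f : 'I_p -> option E) T :
    injective f -> [set f i | i : 'I_p] = None |: [set Some e | e in T] ->
  (\det (incmx int f)) ^+ 2 = `[< spanning_tree T >]%:R.
Proof.
move=> f_inj fT.
have fN : exists i, f i = None.
  have : None \in None |: [set Some e | e in T] by exact: setU11.
  by rewrite -fT => /imsetP[i _ ->]; exists i.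
have fS e : e \in T -> exists i, f i = Some e.
  move=> eT; have : Some e \in None |: [set Some e | e in T].
    exact/setU1r/imset_f.
  by rewrite -fT => /imsetP[i _ ->]; exists i.
case: asboolP => [[connT _]|notT]; first exact: incmx_sqr_det1 connT fN fS.
apply/eqP; rewrite sqrf_eq0; apply: contra_notT notT => det_neq0; split.
  have -> : T = [set e | Some e \in codom f].
    apply/setP=> e; rewrite inE; apply/idP/codomP=> [/fS[i <-]|[i fi]].
      by exists i.
    have : f i \in [set f i | i : 'I_p] by exact: imset_f.
    by rewrite fT -fi !inE /= => /imsetP[e' e'T [->]].
  exact: incmx_det_connected det_neq0.
exact: incmx_det_acyclic f_inj fS det_neq0.
Qed.

End Incidence.

(** * Contraction of a set of rows *)

(** The cast along [p_eq] lets p be the number of vertices, which equals k + m only provably. *)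
Definition join_ord (X : Type) (p k m : nat) (p_eq : p = (k + m)%N)
    (h : 'I_k -> X) (g : 'I_m -> X) (i : 'I_p) : X :=
  match split (cast_ord p_eq i) with inl a => h a | inr b => g b end.

Lemma join_ord_inj (X : Type) (p k m : nat) (p_eq : p = (k + m)%N)
    (h : 'I_k -> X) (g : 'I_m -> X) :
    injective h -> injective g -> (forall i j, h i <> g j) ->
  injective (join_ord p_eq h g).
Proof.
move=> h_inj g_inj hg i j; rewrite /join_ord => eq_ij.
apply: (can_inj (cast_ordK p_eq)); apply: (can_inj splitK).
case: (split _) (split _) eq_ij => [a|a] [b|b] eq_ab.
- by rewrite (h_inj _ _ eq_ab).
- by case: (hg a b).
- by case: (hg b a).
- by rewrite (g_inj _ _ eq_ab).
Qed.

Lemma join_ord_imset (X : finType) (p k m : nat) (p_eq : p = (k + m)%N)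
    (h : 'I_k -> X) (g : 'I_m -> X) :
  [set join_ord p_eq h g i | i : 'I_p] =
    [set h i | i : 'I_k] :|: [set g j | j : 'I_m].
Proof.
apply/setP=> x; rewrite inE; apply/imsetP/orP => [[i _ ->]|].
  by rewrite /join_ord; case: split => a; [left | right]; apply: imset_f.
case=> /imsetP[a _ ->].
  exists (cast_ord (esym p_eq) (unsplit (inl a))) => //.
  by rewrite /join_ord cast_ordKV unsplitK.
exists (cast_ord (esym p_eq) (unsplit (inr a))) => //.
by rewrite /join_ord cast_ordKV unsplitK.
Qed.

(* Contraction: in the quotient by the span of the [b (g j)], coordinatised by
   the remaining vectors of one basis, all maximal minors containing the rows
   [g] are divided by the same determinant. *)
Lemma contract_minors (F : fieldType) (X : Type) (p k m : nat)
    (p_eq : p = (k + m)%N) (b : X -> 'rV[F]_p) (g : 'I_m -> X) (h0 : 'I_k -> X) :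
    \det (\matrix_(i < p) b (join_ord p_eq h0 g i)) != 0 ->
  exists w : X -> 'rV[F]_k, forall h : 'I_k -> X,
    \det (\matrix_(i < p) b (join_ord p_eq h g i)) =
      \det (\matrix_(i < k) w (h i)) *
      \det (\matrix_(i < p) b (join_ord p_eq h0 g i)).
Proof.
subst p; set P := \matrix_(i < _) b (join_ord _ h0 g i) => detP.
have uP : P \in unitmx by rewrite unitmxE unitfE.
exists (fun x => lsubmx (b x *m invmx P)) => h.
rewrite -[X in \det X](mulmxKV uP) det_mulmx; congr (_ * _).
set Q := (X in X *m invmx P).
(* In the basis [P] the rows [g] are the last m unit vectors, whence the block triangular shape. *)
suff -> : Q *m invmx P = block_mx (\matrix_(i < k) lsubmx (b (h i) *m invmx P))
    (ursubmx (Q *m invmx P)) 0 1%:M by rewrite det_ublock det1 mulr1.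
have rowQ i : row i (Q *m invmx P) = b (join_ord erefl h g i) *m invmx P.
  by rewrite row_mul rowK.
have joinl (h' : 'I_k -> X) i : join_ord erefl h' g (lshift m i) = h' i.
  by rewrite /join_ord cast_ord_id (unsplitK (inl i)).
have joinr h' j : join_ord erefl h' g (rshift k j) = g j.
  by rewrite /join_ord cast_ord_id (unsplitK (inr j)).
have rowg j : b (g j) *m invmx P = row (rshift k j) 1%:M.
  by rewrite -(mulmxV uP) row_mul rowK joinr.
rewrite -[LHS]submxK; congr block_mx; apply/row_matrixP=> i.
- rewrite rowK -(joinl h i) -rowQ; apply/rowP=> j; by rewrite !mxE.
- apply/rowP=> j; have /rowP/(_ (lshift m j)) := rowQ (rshift k i).
  rewrite joinr rowg !mxE => ->; rewrite /= (_ : _ == _ = false) //.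
  by apply/eqP=> /(congr1 val) /=; have := ltn_ord j; lia.
- apply/rowP=> j; have /rowP/(_ (rshift k j)) := rowQ (rshift k i).
  by rewrite joinr rowg !mxE => ->; rewrite (inj_eq (@rshift_inj _ _)).
Qed.

(** * Values of the dual polynomial over a finite field *)

Lemma num_zeros0 (F : finFieldType) (M : nat) :
  num_zeros F (0 : {mpoly int[M]}) = (#|F| ^ M)%N.
Proof.
rewrite /num_zeros -[M in RHS]card_ord -card_ffun -cardsT; apply: eq_card => x.
by rewrite !inE rmorph0 meval0 eqxx.
Qed.

Section FreeEdges.
Variables (X : finType) (I J : {set X}).
Local Notation M := #|~: (I :|: J)|.

Lemma setU_free_edges (T : {set X}) : J \subset T -> [disjoint T & I] ->
  J :|: [set enum_val i | i in [set i : 'I_M | enum_val i \in T]] = T.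
Proof.
move=> JT TI; apply/setP=> e; rewrite inE.
apply/orP/idP => [[/(subsetP JT) //|/imsetP[i]]|eT].
  by rewrite inE => iT ->.
case: (boolP (e \in J)) => [|eJ]; [by left | right].
have eIJ : e \in ~: (I :|: J) by rewrite !inE negb_or eJ andbT (disjointFr TI).
by apply/imsetP; exists (enum_rank_in eIJ e); rewrite ?inE enum_rankK_in.
Qed.

Lemma mem_free_edge (S : {set 'I_M}) (i : 'I_M) :
  (enum_val i \in J :|: [set enum_val j | j in S]) = (i \in S).
Proof.
rewrite inE (mem_imset _ _ enum_val_inj).
by have := enum_valP i; rewrite !inE negb_or => /andP[_ /negPf->].
Qed.

Lemma card_setU_free_edges (S : {set 'I_M}) :
  #|J :|: [set enum_val i | i in S]| = (#|J| + #|S|)%N.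
Proof.
rewrite cardsU (card_imset _ enum_val_inj) (_ : _ :&: _ = set0).
  by rewrite cards0 subn0.
apply/setP=> e; rewrite !inE; apply/negP=> /andP[eJ /imsetP[i _ ei]].
by have := enum_valP i; rewrite -ei !inE eJ orbT.
Qed.

End FreeEdges.

(** The sets T between J and the complement of I correspond to the sets S of free indices; the 0/1
    coefficients match the squared minors in [det_weighted_gram]. *)
Lemma eval_dual_poly (G : multigraph) (F : finFieldType) (I J : {set edge G})
    (x : 'I_#|~: (I :|: J)| -> F) : [disjoint I & J] ->
  (map_mpoly (intr : int -> F) (dual_poly I J)).@[x] =
    \sum_(S : {set 'I_#|~: (I :|: J)|})
       `[< spanning_tree (J :|: [set enum_val i | i in S]) >]%:R *
       \prod_(i in S) x i.
Proof.
move=> dIJ; have evalX i : (map_mpoly (intr : int -> F) 'X_i).@[x] = x i.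
  by rewrite (map_mpolyX intr) mevalXU.
rewrite /dual_poly (rmorph_sum (map_mpoly intr)) (rmorph_sum (meval x)).
under eq_bigr => T _.
  rewrite (rmorph_prod (map_mpoly intr)) (rmorph_prod (meval x)).
  rewrite (eq_bigr x) => [|i _]; last exact: evalX.
  over.
under [RHS]eq_bigr do rewrite mulr_natl mulrb.
rewrite -[RHS]big_mkcond /=.
rewrite (reindex_onto (fun S : {set 'I_#|~: (I :|: J)|} =>
    J :|: [set enum_val i | i in S])
  (fun T => [set i | enum_val i \in T])) /=; last first.
  by move=> T /and3P[_ JT TI]; apply: setU_free_edges.
apply: eq_big => S.
  rewrite subsetUl /= -andbA; case: `[< _ >] => //=; apply/andP; split.
    rewrite disjoint_sym -setI_eq0 setIUr setU_eq0 !setI_eq0 dIJ /=.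
    rewrite -setI_eq0; apply/eqP/setP=> e; rewrite !inE; apply/negP.
    case/andP=> eI /imsetP[i _ ei]; have := enum_valP i.
    by rewrite -ei !inE eI.
  by apply/eqP/setP=> i; rewrite inE mem_free_edge.
by move=> _; apply: eq_bigl => i; rewrite mem_free_edge.
Qed.

(** * The matrix-tree theorem for minors of a graph, and the conclusion *)

Lemma dvdn_num_zeros_dual_poly (G : multigraph) (F : finFieldType)
    (I J : {set edge G}) :
    vertex G -> [disjoint I & J] ->
    let k := (graph_rank G - #|J|)%N in let M := #|~: (I :|: J)| in
    (k.*2 < M)%N -> (k + 3 <= M)%N ->
  (#|F| ^ 3 %| num_zeros F (dual_poly I J))%N.
Proof.
move=> root dIJ k M M_gt2k M_ge_k3.
(* A tree [T0] serves as reference basis for the contraction; without one the polynomial is 0 and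
   all q^M points are zeros. *)
have [[T0 [treeT0 JT0 T0I]]|no_tree] := pselect (exists T0 : {set edge G},
    [/\ spanning_tree T0, J \subset T0 & [disjoint T0 & I]]); last first.
  rewrite /dual_poly big_pred0; last first.
    move=> T; apply/negP=> /and3P[/asboolP treeT JT TI].
    by apply: no_tree; exists T.
  by rewrite num_zeros0 dvdn_exp2l // (leq_trans _ M_ge_k3) ?leq_addl.
pose p := #|vertex G|.
have rK := @enum_rankK (vertex G); have sK := @enum_valK (vertex G).
have cardT0 : #|T0|.+1 = p := spanning_tree_card root rK sK treeT0.
pose JN := None |: [set Some e | e in J].
have cardJN : #|JN| = #|J|.+1 := card_None_Some J.
(* The truncated difference [k] is exact because J lies in the tree [T0]; the root row is contracted
   along with J. *)
have p_eq : p = (k + #|JN|)%N.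
  rewrite cardJN /k /graph_rank -/p -cardT0 /=.
  by have := subset_leq_card JT0; lia.
pose g : 'I_#|JN| -> option (edge G) := enum_val.
pose ext (h : 'I_k -> 'I_M) i : option (edge G) := Some (enum_val (h i)).
have ext_inj h : injective h -> injective (join_ord p_eq (ext h) g).
  move=> h_inj; apply: join_ord_inj => [i j [/enum_val_inj/h_inj //]||].
    exact: enum_val_inj.
  move=> i j hg; have := enum_valP j; rewrite -/(g j) -hg !inE /=.
  case/imsetP=> e eJ [hi]; have := enum_valP (h i).
  by rewrite hi !inE eJ orbT.
have ext_im h : [set join_ord p_eq (ext h) g i | i : 'I_p] = None |:
    [set Some e | e in J :|: [set enum_val i | i in [set h i | i : 'I_k]]].
  rewrite join_ord_imset imsetU setUC.
  have -> : [set g j | j : 'I_#|JN|] = JN.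
    apply/setP=> o; apply/imsetP/idP => [[j _ ->]|oJ]; first exact: enum_valP.
    by exists (enum_rank_in oJ o); rewrite // /g enum_rankK_in.
  rewrite setUA; congr (_ :|: _); rewrite -!imset_comp.
  by apply/setP=> o; apply/imsetP/imsetP=> -[i _ ->]; exists i.
pose inc := incidence root (@enum_rank (vertex G)) F.
pose D (h : 'I_k -> 'I_M) := \det (\matrix_(i < p) inc (join_ord p_eq (ext h) g i)).
have D_sqr h : injective h -> D h ^+ 2 =
    `[< spanning_tree (J :|: [set enum_val i | i in [set h i | i : 'I_k]]) >]%:R.
  move=> h_inj; have := incmx_sqr_det root rK sK (ext_inj h h_inj) (ext_im h).
  move/(congr1 (intr : int -> F)); rewrite rmorphXn /= -det_map_mx map_incmx.
  by rewrite rmorph_nat.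
pose S0 : {set 'I_M} := [set i | enum_val i \in T0].
have S0E : J :|: [set enum_val i | i in S0] = T0 by apply: setU_free_edges.
have cardS0 : #|S0| = k.
  by rewrite /k /graph_rank -/p -cardT0 -S0E card_setU_free_edges /= addKn.
have [h0 h0_inj h0S] := imset_ord_ex cardS0.
(* Division by the reference minor, a sign, leaves the squares of the other minors unchanged. *)
have D0_sqr : D h0 ^+ 2 = 1.
  by rewrite D_sqr // h0S S0E; case: asboolP.
have D0_neq0 : D h0 != 0 by rewrite -sqrf_eq0 D0_sqr oner_neq0.
have [w wE] := contract_minors D0_neq0.
pose W : 'M[F]_(M, k) := \matrix_(i < M) w (Some (enum_val i)).
have W_minor h : injective h -> \det (rowsub h W) ^+ 2 =
    `[< spanning_tree (J :|: [set enum_val i | i in [set h i | i : 'I_k]]) >]%:R.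
  move=> h_inj; rewrite -D_sqr // /D wE exprMn D0_sqr mulr1.
  by congr (\det _ ^+ 2); apply/matrixP=> i j; rewrite !mxE.
have detE (x : 'rV[F]_M) : \det (W^T *m diag_mx x *m W) =
    (map_mpoly (intr : int -> F) (dual_poly I J)).@[x 0].
  rewrite eval_dual_poly //.
  apply: etrans (det_weighted_gram (d := fun S : {set 'I_M} =>
    `[< spanning_tree (J :|: [set enum_val i | i in S]) >]%:R) x W_minor) _.
  (* A spanning tree containing J has exactly [k] edges outside J, so restricting to sets of size
     [k] loses no term. *)
  rewrite big_mkcond; apply: eq_bigr => S _ /=; case: eqP => // cardS.
  case: asboolP => [treeS|_]; last by rewrite mul0r.
  case: cardS; have := spanning_tree_card root rK sK treeS.
  by rewrite card_setU_free_edges /k /graph_rank -/p => <- /=; rewrite addKn.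
pose A (x : 'rV[F]_M) := W^T *m diag_mx x *m W.
have A_linear : linear A.
  by move=> c x y; rewrite /A linearP mulmxDr mulmxDl -scalemxAr -scalemxAl.
pose HA := GRing.isLinear.Build F 'rV[F]_M 'M[F]_k *:%R A A_linear.
pose Alin : {linear 'rV[F]_M -> 'M[F]_k} := HB.pack A HA.
have A_sym x : (Alin x)^T = Alin x.
  by rewrite /= /A !trmx_mul trmxK tr_diag_mx mulmxA.
have := dvdn_card_singular_sym_family A_sym M_gt2k M_ge_k3.
rewrite /num_zeros.
pose row_of (x : {ffun 'I_M -> F}) : 'rV[F]_M := \row_i x i.
have row_of_inj : injective row_of.
  by move=> x y /rowP xy; apply/ffunP=> i; have := xy i; rewrite !mxE.
rewrite -(card_imset _ row_of_inj); congr (_ %| _)%N; apply: eq_card => x.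
rewrite inE /= /A detE; apply/idP/imsetP => [x0|[y y0 ->]].
  exists [ffun i => x 0 i]; last by apply/rowP=> i; rewrite mxE ffunE.
  rewrite inE -(eqP x0); apply/eqP/meval_eq => i; by rewrite ffunE.
move: y0; rewrite inE => /eqP <-; apply/eqP/meval_eq => i; by rewrite mxE.
Qed.

Theorem corollary34 (R : realType) (G : multigraph)
  (G_planar : planar G R)
  (G_log : log_divergent G)
  (hG_ge3 : 3 <= loop_number G)
  (nG_ge3 : (3 <= graph_rank G)%N) :
  duality_admissible G.
Proof.
split=> // F I J dIJ ltIJ leJ leI.
have cardE : num_edges G = (graph_rank G).*2.
  by move: G_log; rewrite /log_divergent /loop_number; lia.
have cardM : (#|~: (I :|: J)| = (graph_rank G).*2 - (#|I| + #|J|))%N.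
  rewrite -cardE /num_edges -(cardsC (I :|: J)) cardsU disjoint_setI0 // cards0 subn0.
  by rewrite addKn.
have /card_gt0P[root _] : (0 < #|vertex G|)%N.
  by move: nG_ge3; rewrite /graph_rank; case: #|_|.
(* With n the graph rank, k = n - |J| and M = 2n - |I| - |J|, one has M - 2k = |J| - |I| > 0 and M -
   k = n - |I| >= 3. *)
by apply: dvdn_num_zeros_dual_poly => //; rewrite ?cardM; lia.
Qed.
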